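(* Let $K$ be an algebraically closed field, and let $n,d$ be integers with $2\le d<n$, $(n,d)=1$ and $(\mathrm{char}(K),d)=1$. Let $f(x)\in K[x]$ be a monic polynomial of degree $n$ without repeated roots, with roots $w_1,\dots,w_n\in K$, and let $\mathcal C_{f,d}$ be a smooth projective model of the smooth plane affine curve $C_{f,d}: y^d=f(x)$. Then: (i) If $P$ is a point of order $m>1$ on $\mathcal C_{f,d}$, then either $m=d$ or $m\ge n$. (ii) There are precisely $n$ points of order $d$ on $\mathcal C_{f,d}$, namely $P_j=(w_j,0)\in C_{f,d}(K)\subset\mathcal C_{f,d}(K)$, $j=1,\dots,n$. (iii) A point $P=(a,c)\in C_{f,d}(K)\subset \mathcal C_{f,d}(K)$ has order $n$ if and only if there exists a polynomial $v(x)\in K[x]$ such that $$\deg(v)\le\frac{n-1}{d},\qquad f(x)=(x-a)^n+v(x)^d.$$ (iv) The curve $\mathcal C_{f,d}$ has a point of order $n$ if and only if there exist $a\in K$ and a polynomial $v(x)\in K[x]$ such that $$\deg(v)\le\frac{n-1}{d},\qquad f(x)=(x-a)^n+v(x)^d.$$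
   Context: The condition $(\mathrm{char}(K),d)=1$ means that $\mathrm{char}(K)$ does not divide $d$ (automatic in characteristic $0$). Since $(n,d)=1$, the smooth projective model $\mathcal C_{f,d}$ has exactly one point not lying on the affine curve $C_{f,d}$; it is denoted $\infty$, so $\mathcal C_{f,d}(K)=C_{f,d}(K)\sqcup\{\infty\}$. The curve $\mathcal C_{f,d}$ is embedded in its Jacobian $J(\mathcal C_{f,d})$ by sending $P$ to the linear equivalence class of the divisor $(P)-(\infty)$. A point $P\in\mathcal C_{f,d}(K)$ is said to have order $m$ if the class of $(P)-(\infty)$ has order exactly $m$ in the group $J(\mathcal C_{f,d})(K)$. *)

(* Defs.v *)
From HB Require Import structures.
From mathcomp Require Import all_boot all_order all_algebra.
From mathcomp Require Import boolp.
From mathcomp Require Import freeg.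

Set Implicit Arguments.
Unset Strict Implicit.
Unset Printing Implicit Defensive.

Import Order.TTheory GRing.Theory Num.Theory.
Local Open Scope ring_scope.
Local Open Scope quotient_scope.

(* The value p(x, y) in L of p in K[X][Y], where iota : K -> L. *)
Definition eval2 (K L : fieldType) (iota : {rmorphism K -> L}) (x y : L)
    (p : {poly {poly K}}) : L :=
  (map_poly (fun g : {poly K} => (map_poly iota g).[x]) p).[y].

(* A function field of the affine curve y^d = f(x): a fraction field of its   *)
(* coordinate ring K[X][Y] / (Y^d - f(X)).  The axiom ff_ker says that this   *)
(* ring embeds into ff_field, and ff_gen that ff_field is its fraction field. *)
Record function_field (K : closedFieldType) (f : {poly K}) (d : nat) :=
  FunctionField {
    ff_field :> fieldType;
    ff_const : {rmorphism K -> ff_field};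
    ff_x : ff_field;
    ff_y : ff_field;
    ff_ker : forall p : {poly {poly K}},
      eval2 ff_const ff_x ff_y p = 0 <->
      exists q : {poly {poly K}}, p = q * ('X^d - f%:P);
    ff_gen : forall h : ff_field, exists p q : {poly {poly K}},
      eval2 ff_const ff_x ff_y q != 0 /\
      h = eval2 ff_const ff_x ff_y p / eval2 ff_const ff_x ff_y q
  }.

(* The smooth projective model of a curve over an algebraically closed field  *)
(* K is determined by its function field L: its K-points are the discrete     *)
(* valuations of L that are trivial on K, normalized to have value group Z;   *)
(* ord P h is the order of vanishing of h at P.  The value at 0 is a          *)
(* convention, which makes two points equal as soon as their valuations agree *)
(* on L \ {0}.                                                                *)
Record point (K : closedFieldType) (f : {poly K}) (d : nat)
    (C : function_field f d) := Point {
  ord : C -> int;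
  ord0 : ord 0 = 0;
  ordM : forall g h : C, g != 0 -> h != 0 -> ord (g * h) = ord g + ord h;
  ordD : forall g h : C, g != 0 -> h != 0 -> g + h != 0 ->
    Num.min (ord g) (ord h) <= ord (g + h);
  ord_const : forall a : K, a != 0 -> ord (ff_const C a) = 0;
  ord_uniformizer : exists t : C, t != 0 /\ ord t = 1
}.

HB.instance Definition _ (K : closedFieldType) (f : {poly K}) (d : nat)
  (C : function_field f d) := gen_eqMixin (point C).
HB.instance Definition _ (K : closedFieldType) (f : {poly K}) (d : nat)
  (C : function_field f d) := gen_choiceMixin (point C).

Section Curve.
Variables (K : closedFieldType) (f : {poly K}) (d : nat).
Variable C : function_field f d.

(* P is the point of the smooth projective model given by the point (a, c) of *)
(* the affine curve: x - a and y - c belong to the maximal ideal of P.  Since *)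
(* ord P 0 = 0, these functions are required to be nonzero, which they are on *)
(* this curve.                                                                *)
Definition is_affine_point (P : point C) (a c : K) : Prop :=
  0 < ord P (ff_x C - ff_const C a) /\ 0 < ord P (ff_y C - ff_const C c).

Definition is_infinity (P : point C) : Prop :=
  forall a c : K, ~ is_affine_point P a c.

Definition deg0 : pred {freeg (point C)} := fun D => deg D == 0.

Lemma deg0_zmod_closed : zmod_closed deg0.
Proof.
split=> [|D E]; rewrite /deg0 !unfold_in ?raddf0 // => /eqP D0 /eqP E0.
by rewrite raddfB /= D0 E0 subrr.
Qed.

HB.instance Definition _ :=
  GRing.isZmodClosed.Build {freeg (point C)} deg0 deg0_zmod_closed.

Record div0 := Div0 { div0_val :> {freeg (point C)}; _ : div0_val \in deg0 }.
HB.instance Definition _ := [isSub for div0_val].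
HB.instance Definition _ := [Choice of div0 by <:].
HB.instance Definition _ := [SubChoice_isSubZmodule of div0 by <:].

Definition principal : pred div0 := fun D =>
  `[< exists h : C, h != 0 /\
        forall P : point C, coeff P (div0_val D) = ord P h >].

Lemma ord1 (P : point C) : ord P 1 = 0.
Proof. by rewrite -(rmorph1 (ff_const C)) ord_const ?oner_neq0. Qed.

Lemma ordV (P : point C) (h : C) : h != 0 -> ord P h^-1 = - ord P h.
Proof.
move=> h0; apply/eqP; rewrite -addr_eq0 -ordM ?invr_eq0 //.
by rewrite mulVf // ord1.
Qed.

Lemma principal_zmod_closed : zmod_closed principal.
Proof.
split=> [|D E].
  apply/asboolP; exists 1; split; first exact: oner_neq0.
  by move=> P; rewrite ord1 !raddf0.
move=> /asboolP[g [g0 gD]] /asboolP[h [h0 hE]].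
apply/asboolP; exists (g / h); split; first by rewrite mulf_neq0 ?invr_eq0.
by move=> P; rewrite ordM ?invr_eq0 // ordV // -gD -hE !raddfB.
Qed.

HB.instance Definition _ :=
  GRing.isZmodClosed.Build div0 principal principal_zmod_closed.

Definition principal_divisors : zmodClosed div0 :=
  GRing.ZmodClosed.clone div0 principal _.

(* The group J(C)(K), as the group Pic^0 of linear equivalence classes of     *)
(* divisors of degree 0.                                                      *)
Definition jacobian : zmodType := {ideal_quot principal_divisors}.

Lemma deg0_sub (P Q : point C) : <<P>> - <<Q>> \in deg0.
Proof. by rewrite unfold_in /deg0 raddfB /= !degU subrr. Qed.

Definition to_jacobian (inf P : point C) : jacobian :=
  \pi_{ideal_quot principal_divisors} (Div0 (deg0_sub P inf)).

Definition point_has_order (inf P : point C) (m : nat) : Prop :=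
  let g := to_jacobian inf P in
  [/\ (0 < m)%N, g *+ m = 0 & forall k : nat, (0 < k < m)%N -> g *+ k <> 0].

End Curve.

(* Main.v *)
Require Import Defs.
From mathcomp Require Import all_boot all_order all_algebra.
From HB Require Import structures.
From mathcomp Require Import boolp freeg separable zify ring.

Set Implicit Arguments.
Unset Strict Implicit.
Unset Printing Implicit Defensive.

Import Order.TTheory GRing.Theory Num.Theory.
Local Open Scope ring_scope.

(* If m(P) - m(oo) = div(h), then h has no pole on the affine curve, hence    *)
(* h = sum_(i < d) g_i(x) y^i.  At infinity x and y have poles of order d and *)
(* n, and (n, d) = 1 makes the orders d deg(g_i) + n i of the terms distinct, *)
(* so their maximum is m.                                                     *)
(* - If m < n, then h = g_0(x) and m = d deg(g_0).  Since P is the only zero  *)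
(*   of h, it is the only point over its x-coordinate, so P = (w_j, 0), and   *)
(*   d(P) - d(oo) = div(x - w_j).                                             *)
(* - If m = n, then up to a constant h = y - v(x) with d deg(v) < n.  A root  *)
(*   b of f - v^d gives the zero (b, v(b)) of h, so f - v^d = (x - a)^n.      *)
(*   Conversely the latter gives div(y - v(x)) = n(P) - n(oo) for P = (a, c), *)
(*   once v is scaled by a d-th root of unity so that v(a) = c.               *)
(* Points being valuations, those centered at (a, c) are constructed by       *)
(* dividing by a local parameter as often as possible, which terminates       *)
(* because every function on the curve has a nonzero multiple in K[x].        *)

(** The outline above needs two facts about the curve. First, its points are known:
    [affine_point_exists] and [affine_point_unique] give exactly one valuation over each solution of
    c^d = f(a), and by [affine_or_pole] and [pole_unique] the only other point is infinity, where
    [pole_ord_poly] reads the order of a nonzero polynomial of Y-degree below d off its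
    coefficients. Second, a function without affine poles is such a polynomial ([regular_ev]).

    Hence, for P other than infinity and m > 0, a relation m(P) ~ m(oo) amounts to a polynomial of
    pole order m whose only affine zero is P ([multiple_poly], [multiple_zero]). [multiple_lt_n]
    exploits this for m < n and [order_n_power] for m = n; [ramified_multiple] and [power_order_n]
    compute the divisors of x - a and y - v(x) for the converse directions. *)

Section Eval2.
Variables (K L : fieldType) (iota : {rmorphism K -> L}) (x y : L).

Lemma eval2E p :
  eval2 iota x y p = (map_poly (horner_eval x \o map_poly iota) p).[y].
Proof. by []. Qed.

Lemma eval2_zmod_morphism : zmod_morphism (eval2 iota x y).
Proof. by move=> p q; rewrite !eval2E rmorphB hornerD hornerN. Qed.

Lemma eval2_monoid_morphism : monoid_morphism (eval2 iota x y).
Proof.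
by split=> [|p q]; rewrite !eval2E ?rmorph1 ?hornerC // rmorphM hornerM.
Qed.

HB.instance Definition _ :=
  GRing.isZmodMorphism.Build _ _ (eval2 iota x y) eval2_zmod_morphism.
HB.instance Definition _ :=
  GRing.isMonoidMorphism.Build _ _ (eval2 iota x y) eval2_monoid_morphism.

Lemma eval2C g : eval2 iota x y g%:P = (map_poly iota g).[x].
Proof. by rewrite eval2E map_polyC hornerC. Qed.

Lemma eval2X : eval2 iota x y 'X = y.
Proof. by rewrite eval2E map_polyX hornerX. Qed.

End Eval2.

(** * Normal forms in the coordinate ring, and denominators in K[x] *)

Section FunctionField.
Variables (K : closedFieldType) (f : {poly K}) (d : nat).
Variable C : function_field f d.
Implicit Types (g : {poly K}) (p q u : {poly {poly K}}) (h : C).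

Definition ev : {poly {poly K}} -> C :=
  eval2 (ff_const C) (ff_x C) (ff_y C).
HB.instance Definition _ := GRing.RMorphism.copy ev
  (eval2 (ff_const C) (ff_x C) (ff_y C)).

Lemma evD p q : ev (p + q) = ev p + ev q.
Proof. exact: rmorphD. Qed.

Lemma evB p q : ev (p - q) = ev p - ev q.
Proof. exact: rmorphB. Qed.

Lemma evM p q : ev (p * q) = ev p * ev q.
Proof. exact: rmorphM. Qed.

Lemma evXn p k : ev (p ^+ k) = ev p ^+ k.
Proof. exact: rmorphXn. Qed.

Lemma evX : ev 'X = ff_y C.
Proof. exact: eval2X. Qed.

Lemma ev_polyC g : ev g%:P = (map_poly (ff_const C) g).[ff_x C].
Proof. exact: eval2C. Qed.

Lemma evCX : ev 'X%:P = ff_x C.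
Proof. by rewrite ev_polyC map_polyX hornerX. Qed.

Lemma evCC c : ev c%:P%:P = ff_const C c.
Proof. by rewrite ev_polyC map_polyC hornerC. Qed.

Lemma evXsubC a : ev ('X - a%:P)%:P = ff_x C - ff_const C a.
Proof. by rewrite polyCB rmorphB /= evCX evCC. Qed.

Lemma evYsubC c : ev ('X - c%:P%:P) = ff_y C - ff_const C c.
Proof. by rewrite rmorphB /= evX evCC. Qed.

Lemma ev_curve : ff_y C ^+ d = ev f%:P.
Proof.
apply/eqP; rewrite -subr_eq0 -evX -rmorphXn -rmorphB; apply/eqP.
by apply/ff_ker; exists 1; rewrite mul1r.
Qed.

Hypothesis d_gt0 : (0 < d)%N.

Lemma size_curve : size ('X^d - f%:P) = d.+1.
Proof. exact: size_XnsubC. Qed.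

Lemma curve_monic : 'X^d - f%:P \is monic.
Proof. exact: monicXnsubC. Qed.

(** The equation of the curve is monic of degree d in Y, so its nonzero multiples have degree at
    least d. With [ev_rep], polynomials of size at most d become normal forms. *)
Lemma ev_eq0 (p : {poly {poly K}}) : (size p <= d)%N -> ev p = 0 -> p = 0.
Proof.
move=> sz /ff_ker[q Ep]; have [q0|q0] := eqVneq q 0;
  first by rewrite Ep q0 mul0r.
move: sz; rewrite Ep size_Mmonic ?curve_monic // size_curve addnS /=.
by rewrite leqNgt -[X in (X < _)%N]add0n ltn_add2r lt0n size_poly_eq0 q0.
Qed.

Lemma evC_neq0 g : g != 0 -> ev g%:P != 0.
Proof.
apply: contra_neq => /ev_eq0; rewrite (leq_trans (size_polyC_leq1 _)) // => /(_
  isT).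
by move/eqP; rewrite polyC_eq0 => /eqP.
Qed.

Lemma ev_rep (p : {poly {poly K}}) : exists2 q : {poly {poly K}},
  (size q <= d)%N & ev p = ev q.
Proof.
exists (Pdiv.Ring.rmodp p ('X^d - f%:P)).
  by rewrite -ltnS -size_curve Pdiv.Ring.ltn_rmodpN0 ?monic_neq0 ?curve_monic.
rewrite {1}(Pdiv.RingMonic.rdivp_eq curve_monic p) rmorphD rmorphM /=.
by rewrite rmorphB rmorphXn /= evX ev_curve subrr mulr0 add0r.
Qed.

(* The kernel of [ev] is prime, so a resultant with the equation of the curve *)
(* is nonzero.                                                                *)
Lemma ev_elim (q : {poly {poly K}}) : ev q != 0 ->
  exists u g, g != 0 /\ ev u * ev q = ev g%:P.
Proof.
move=> q0; have [q1|q1] := leqP (size q) 1.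
  exists 1, q`_0; rewrite rmorph1 mul1r -size1_polyC //; split=> //.
  by apply: contra_neq q0 => q00; rewrite (size1_polyC q1) q00 rmorph0.
have sc : (1 < size ('X^d - f%:P)%R)%N by rewrite size_curve ltnS.
have [[u v] /= _ E] := resultant_in_ideal q1 sc.
exists u, (resultant q ('X^d - f%:P)); split; last first.
  rewrite E rmorphD !rmorphM /= rmorphB rmorphXn /= evX ev_curve.
  by rewrite subrr mulr0 addr0.
(* A zero resultant would yield a common factor g of positive Y-degree. Up to a scalar g divides q,
   so [ev g] is nonzero and [ev] kills the cofactor [q2] of g in the equation; but [q2] has size at
   most d, so [ev_eq0] makes it 0. *)
rewrite resultant_eq0 -leqNgt leqNgt; apply/negP => sg.
set g := gcdp _ _ in sg.
have /Pdiv.Idomain.dvdpP[[c1 q'] /= c10 E1] : (g %| q)%R by apply: dvdp_gcdl.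
have /Pdiv.Idomain.dvdpP[[c2 q2] /= c20 E2] : (g %| ('X^d - f%:P))%R.
  exact: dvdp_gcdr.
have gev : ev g != 0.
  apply: contra_neq q0 => g0; apply/eqP; move/(congr1 ev)/eqP: E1.
  by rewrite -mul_polyC !rmorphM /= g0 mulr0 mulf_eq0 (negPf (evC_neq0 c10)).
have : ev (q2 * g) = 0.
  by rewrite -E2 -mul_polyC rmorphM rmorphB rmorphXn /= evX ev_curve subrr
    mulr0.
move/eqP; rewrite rmorphM mulf_eq0 (negPf gev) orbF => /eqP/ev_eq0 q20.
have g0 : g != 0 by rewrite -size_poly_gt0 (ltn_trans _ sg).
have sz : (size (q2 * g)).-1 = d by rewrite -E2 size_scale // size_curve.
have [q20'|q2n0] := eqVneq q2 0; first by move: d_gt0;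
  rewrite -sz q20' mul0r size_poly0.
have le s t : (s + t).-1.-1 = d -> (1 < t)%N -> (s <= d)%N by lia.
apply: (negP q2n0); apply/eqP/q20.
by rewrite size_mul // in sz; apply: le sz sg.
Qed.

Lemma ev_frac h : exists p g, g != 0 /\ h * ev g%:P = ev p.
Proof.
have [p [q [q0 ->]]] := ff_gen h.
have [u [g [g0 E]]] := ev_elim q0.
exists (p * u), g; split=> //.
by rewrite -E rmorphM mulrCA !mulrA mulrAC -mulrA divff // mulr1 mulrC.
Qed.

End FunctionField.

(** * Valuations *)

Section Valuation.
Variables (K : closedFieldType) (f : {poly K}) (d : nat).
Variables (C : function_field f d) (P : point C).
Implicit Types (g h : C) (k l : int).

(** As [ord P 0] is 0 by convention, the first disjunct restores the infinite order of 0, so that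
    the condition is stable under sums. *)
Definition ord_ge k h := (h == 0) || (k <= ord P h).

Lemma ord_ge0 k : ord_ge k 0.
Proof. by rewrite /ord_ge eqxx. Qed.

Lemma ord_geE k h : h != 0 -> ord_ge k h = (k <= ord P h).
Proof. by rewrite /ord_ge => /negPf ->. Qed.

Lemma ord_ge_refl h : ord_ge (ord P h) h.
Proof. by rewrite /ord_ge lexx orbT. Qed.

Lemma ord_ge_trans k l h : k <= l -> ord_ge l h -> ord_ge k h.
Proof. by move=> kl /orP[/eqP->|/(le_trans kl) le];
  rewrite /ord_ge ?eqxx ?le ?orbT. Qed.

Lemma ord_geD k g h : ord_ge k g -> ord_ge k h -> ord_ge k (g + h).
Proof.
have [->|g0] := eqVneq g 0; first by rewrite add0r.
have [->|h0] := eqVneq h 0; first by rewrite addr0.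
have [->|gh0] := eqVneq (g + h) 0; first by rewrite ord_ge0.
rewrite !ord_geE // => kg kh; apply: le_trans (ordD P g0 h0 gh0).
by rewrite le_min kg.
Qed.

Lemma ord_geM k l g h : ord_ge k g -> ord_ge l h -> ord_ge (k + l) (g * h).
Proof.
have [->|g0] := eqVneq g 0; first by rewrite mul0r !ord_ge0.
have [->|h0] := eqVneq h 0; first by rewrite mulr0 !ord_ge0.
by rewrite !ord_geE ?mulf_neq0 // ordM // => kg lh; apply: lerD.
Qed.

Lemma ord_geMr k g h : ord_ge 0 g -> ord_ge k h -> ord_ge k (g * h).
Proof. by move=> g0 hk; rewrite -[k]add0r ord_geM. Qed.

Lemma ord_ge_const c : ord_ge 0 (ff_const C c).
Proof.
have [->|c0] := eqVneq c 0; first by rewrite rmorph0 ord_ge0.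
by rewrite /ord_ge ord_const // lexx orbT.
Qed.

Lemma ordN h : ord P (- h) = ord P h.
Proof.
have [->|h0] := eqVneq h 0; first by rewrite oppr0.
rewrite -mulN1r ordM ?oppr_eq0 ?oner_neq0 // -(rmorph1 (ff_const C)) -rmorphN.
by rewrite ord_const ?oppr_eq0 ?oner_neq0 // add0r.
Qed.

Lemma ord_geN k h : ord_ge k (- h) = ord_ge k h.
Proof. by rewrite /ord_ge oppr_eq0 ordN. Qed.

Lemma ord_geB k g h : ord_ge k g -> ord_ge k h -> ord_ge k (g - h).
Proof. by move=> kg kh; rewrite ord_geD ?ord_geN. Qed.

Lemma ord_ge_sum k (I : eqType) (r : seq I) (Q : pred I) (F : I -> C) :
  (forall i, i \in r -> Q i -> ord_ge k (F i)) ->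
  ord_ge k (\sum_(i <- r | Q i) F i).
Proof.
move=> kF; rewrite big_seq_cond.
apply: (big_ind (fun h => ord_ge k h)) => [|g h|i /andP[ir Qi]].
- exact: ord_ge0.
- exact: ord_geD.
- exact: kF.
Qed.

Lemma ordX h m : h != 0 -> ord P (h ^+ m) = ord P h *+ m.
Proof.
move=> h0; elim: m => [|m IH]; first by rewrite expr0 mulr0n Defs.ord1.
by rewrite exprS ordM ?expf_neq0 // IH mulrS.
Qed.

Lemma ordXz h k : h != 0 -> ord P (h ^ k) = ord P h * k.
Proof.
move=> h0; case: k => m; first by rewrite -exprnP ordX // -mulr_natr natz.
by rewrite NegzE -exprnN ordV ?expf_neq0 // ordX // -mulr_natr natz mulrN.
Qed.

(** Were the order of g + h larger than that of g, then g = (g + h) - h would have order larger than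
    its own. *)
Lemma ord_ltD g h : g != 0 -> ord_ge (ord P g + 1) h ->
  g + h != 0 /\ ord P (g + h) = ord P g.
Proof.
move=> g0 gh; have g1h : ord P g + 1 <= ord P g = false by lia.
have gh0 : g + h != 0.
  apply: contraFneq g1h => /eqP; rewrite addr_eq0 => /eqP Eg.
  by move: gh; rewrite -ord_geN -Eg ord_geE.
split=> //; apply/eqP; rewrite eq_le andbC -ord_geE // ord_geD ?ord_ge_refl
  //=; last first.
  by apply: ord_ge_trans gh; lia.
rewrite leNgt -lezD1; apply/negP => lt.
have : ord_ge (ord P g + 1) ((g + h) - h) by rewrite ord_geB // ord_geE.
by rewrite addrK ord_geE // g1h.
Qed.

Lemma ord_sub_const h c : 0 < ord P (h - ff_const C c) ->
  forall c', c' != c -> h - ff_const C c' != 0 /\ ord P (h - ff_const C c') = 0.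
Proof.
move=> hc c' c'c.
have cc : ff_const C (c - c') != 0 by rewrite fmorph_eq0 subr_eq0 eq_sym.
have oc : ord P (ff_const C (c - c')) = 0 by rewrite ord_const // subr_eq0
  eq_sym.
rewrite (_ : h - _ = ff_const C (c - c') + (h - ff_const C c)); last first.
  by rewrite rmorphB; ring.
by rewrite -oc; apply: ord_ltD cc _; rewrite oc /ord_ge; lia.
Qed.

Lemma ord_gt0_ge k h : 0 < ord P h -> k <= 1 -> ord_ge k h.
Proof. by move=> h0 k1; rewrite /ord_ge; lia. Qed.

Lemma ev_ge0 (p : {poly {poly K}}) :
  ord_ge 0 (ff_x C) -> ord_ge 0 (ff_y C) -> ord_ge 0 (ev C p).
Proof.
move=> x0 y0; elim/poly_ind: p => [|p g IH]; first by rewrite rmorph0 ord_ge0.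
rewrite evD evM evX ord_geD //; first by rewrite mulrC ord_geMr.
elim/poly_ind: g => [|g c IHg]; first by rewrite !rmorph0 ord_ge0.
rewrite polyCD polyCM evD evM evCX evCC ord_geD ?ord_ge_const //.
by rewrite mulrC ord_geMr.
Qed.

End Valuation.

(** * The point over a point of the affine curve *)

Section AffinePoint.
Variables (K : closedFieldType) (f : {poly K}) (d : nat).
Variable C : function_field f d.
Hypotheses (d_gt1 : (1 < d)%N) (dK : d%:R != 0 :> K) (f_sep : separable_poly f).
Variables (a c : K).
Hypothesis fac : c ^+ d = f.[a].
Local Notation ev := (ev C).
Implicit Types (p q r s : {poly {poly K}}) (h : C).

Let d_gt0 : (0 < d)%N. Proof. exact: ltnW. Qed.

Lemma ev0_at p : ev p = 0 -> p.[c, a] = 0.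
Proof. by move/ff_ker=> [q ->]; rewrite !hornerE fac subrr mulr0. Qed.

Lemma ev_at_neq0 p : p.[c, a] != 0 -> ev p != 0.
Proof. by apply: contra_neq => /ev0_at. Qed.

(** A local parameter at (a, c): the tangent is vertical where c = 0, so y is used there, and x - a
    elsewhere. *)
Definition unif : {poly {poly K}} := if c == 0 then 'X else ('X - a%:P)%:P.

Lemma unif_at : unif.[c, a] = 0.
Proof. by rewrite /unif; have [->|_] := eqVneq c 0; rewrite !hornerE // subrr.
Qed.

Lemma ev_unif_neq0 : ev unif != 0.
Proof.
rewrite /unif; have [_|_] := eqVneq c 0;
  last by rewrite evC_neq0 // polyXsubC_eq0.
by apply/eqP=> /(ev_eq0 d_gt0); rewrite size_polyX => /(_ d_gt1)/eqP;
  rewrite polyX_eq0.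
Qed.

(* Smoothness at [(a, c)]: separability of [f] gives the first lemma, and     *)
(* [d <> 0] in [K] the second.                                                *)
Lemma vertical_tangent : c = 0 -> exists f1 : {poly K},
  f1.[a] != 0 /\ ev f1%:P * (ff_x C - ff_const C a) = ff_y C ^+ d.
Proof.
move=> c0; have /factor_theorem[f1 Ef] : root f a.
  by rewrite rootE -fac c0 expr0n -leqn0 leqNgt d_gt0.
exists f1; split; last by rewrite ev_curve -evXsubC -rmorphM -polyCM -Ef.
by move: f_sep; rewrite Ef separable_root => /andP[].
Qed.

Lemma horizontal_tangent : c != 0 -> exists s (f2 : {poly K}),
  s.[c, a] != 0 /\ ev s * (ff_y C - ff_const C c) = ev f2%:P * (ff_x C -
    ff_const C a).
Proof.
move=> c0; have /factor_theorem[s Es] : root ('X^d - (c ^+ d)%:P%:P) c%:P.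
  by rewrite rootE !hornerE polyC_exp subrr.
have /factor_theorem[f2 Ef] : root (f - (c ^+ d)%:P) a.
  by rewrite rootE !hornerE fac subrr.
exists s, f2; split.
  (* Differentiating Y^d - c^d = s (Y - c) at Y = c gives s(c) = d c^(d-1). *)
  move/(congr1 deriv)/(congr1 (horner^~ c%:P))/(congr1 (horner^~ a)): Es.
  rewrite derivB derivC derivXn derivM derivXsubC !hornerE subrr mulr0 add0r.
  move=> <-; rewrite hornerMn !hornerE -polyC_exp hornerMn hornerC.
  by rewrite subr0 -mulr_natr mulf_neq0 ?expf_neq0.
rewrite -evYsubC -evXsubC -2!evM -polyCM -Es -Ef polyCB.
rewrite 2!evB.
by rewrite evXn evX ev_curve.
Qed.

Lemma at_decomp q : q.[c, a] = 0 -> exists u (v : {poly K}),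
  q = u * ('X - c%:P%:P) + (v * ('X - a%:P))%:P.
Proof.
move=> q0; have /factor_theorem[u Eu] : root (q - (q.[c%:P])%:P) c%:P.
  by rewrite rootE !hornerE subrr.
have /factor_theorem[v Ev] : root q.[c%:P] a by apply/rootP.
by exists u, v; rewrite -Eu -Ev subrK.
Qed.

(** In the local ring at (a, c) the maximal ideal is generated by [unif]: y - c and x - a generate
    it, and the tangent lemmas express one through the other after multiplication by a unit, here
    the factor s. *)
Lemma at_div_unif q : q.[c, a] = 0 -> exists s r,
  s.[c, a] != 0 /\ ev s * ev q = ev unif * ev r.
Proof.
move=> /at_decomp[u [v ->]]; rewrite /unif.
have [c0|c0] := eqVneq c 0.
  have [f1 [f1a E]] := vertical_tangent c0.
  exists f1%:P, (f1%:P * u + v%:P * 'X^(d.-1)); split; first by rewrite hornerC.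
  have Ey : ff_y C ^+ d = ff_y C * ff_y C ^+ d.-1 by rewrite -exprS prednK.
  rewrite (evD _ (u * _)) (evD _ (f1%:P * _)) polyCM !evM evXn evXsubC evYsubC
    c0 rmorph0 subr0 evX.
  by rewrite mulrDr [X in _ + X]mulrCA E Ey; ring.
have [s [f2 [s0 E]]] := horizontal_tangent c0.
exists s, (u * f2%:P + s * v%:P); split=> //.
rewrite (evD _ (u * _)) (evD _ (u * f2%:P)) polyCM !evM evXsubC evYsubC mulrDr
  mulrCA E.
by ring.
Qed.

(** h is [unif] to the power k times a unit r / s of the local ring. It is a relation, since k
    exists only once division by [unif] is known to terminate. *)
Definition local_ord h (k : int) := exists r s,
  [/\ r.[c, a] != 0, s.[c, a] != 0 & h * ev s = ev unif ^ k * ev r].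

Lemma local_ord_neq0 h k : local_ord h k -> h != 0.
Proof.
case=> r [s [r0 s0 E]]; apply/eqP=> h0; move/eqP: E; rewrite h0 mul0r eq_sym.
by rewrite mulf_eq0 (negPf (ev_at_neq0 r0)) orbF expfz_eq0 (negPf ev_unif_neq0)
  andbF.
Qed.

Lemma local_ord_at r : r.[c, a] != 0 -> local_ord (ev r) 0.
Proof.
move=> r0; exists r, 1; split=> //; first by rewrite !hornerE oner_neq0.
by rewrite rmorph1 mulr1 expr0z mul1r.
Qed.

Lemma local_ord_unifXz k : local_ord (ev unif ^ k) k.
Proof. by exists 1, 1; split; rewrite ?hornerE ?oner_neq0. Qed.

Lemma local_ord_unif : local_ord (ev unif) 1.
Proof. by have := local_ord_unifXz 1; rewrite expr1z. Qed.

Lemma local_ordM g h k l :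
  local_ord g k -> local_ord h l -> local_ord (g * h) (k + l).
Proof.
case=> r [s [r0 s0 E]] [r' [s' [r0' s0' E']]]; exists (r * r'), (s * s').
split; rewrite ?hornerM ?mulf_neq0 //.
by rewrite !evM mulrACA E E' expfzDr ?ev_unif_neq0 // mulrACA.
Qed.

Lemma local_ordV h k : local_ord h k -> local_ord h^-1 (- k).
Proof.
move=> hk; have h0 := local_ord_neq0 hk; case: hk => r [s [r0 s0 E]].
exists s, r; split=> //; apply: (mulfI h0);
  rewrite mulrA divff // mul1r mulrCA E.
by rewrite mulrA -expfzDr ?ev_unif_neq0 // addNr expr0z mul1r.
Qed.

Lemma local_ordX h k m : local_ord h k -> local_ord (h ^+ m) (k * m%:Z).
Proof.
move=> hk; elim: m => [|m IH].
  by rewrite mulr0 expr0 -(rmorph1 ev); apply: local_ord_at;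
    rewrite !hornerE oner_neq0.
by rewrite exprS intS mulrDr mulr1; apply: local_ordM.
Qed.

(** If k were negative, the unit r would equal q s times a positive power of [unif], hence vanish at
    (a, c). *)
Lemma local_ord_ge0 q k : local_ord (ev q) k -> 0 <= k.
Proof.
case=> r [s [r0 s0 E]]; case: k E => // m; rewrite NegzE -exprnN => E.
have : (r - q * s * unif ^+ m.+1).[c, a] = 0.
  apply: ev0_at; rewrite evB !evM evXn E mulrAC mulVf ?mul1r ?subrr //.
  by rewrite expf_neq0 // ev_unif_neq0.
by rewrite !hornerE unif_at exprS mul0r mulr0 subr0 => /eqP; rewrite (negPf r0).
Qed.

(** The function 1 = h / h gets both orders k - l and l - k, and neither is negative because 1 is a
    polynomial. *)
Lemma local_ord_uniq h k l : local_ord h k -> local_ord h l -> k = l.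
Proof.
have le k' l' : local_ord h k' -> local_ord h l' -> k' <= l'.
  move=> hk hl; rewrite -subr_ge0; case: (hk) => r [s [r0 s0 E]].
  have h0 := local_ord_neq0 hk.
  have := local_ordM hl (local_ordV hk); rewrite divff // -(rmorph1 ev).
  exact: local_ord_ge0.
by move=> hk hl; apply/eqP; rewrite eq_le !le.
Qed.

Lemma local_ord_XsubC :
  local_ord (ff_x C - ff_const C a) (if c == 0 then d%:Z else 1).
Proof.
have [c0|c0] := eqVneq c 0; last first.
  by have := local_ord_unif; rewrite /unif (negPf c0) evXsubC.
have [f1 [f1a E]] := vertical_tangent c0.
have f10 : (f1%:P).[c, a] != 0 by rewrite hornerC.
have := local_ordX d local_ord_unif; rewrite {1}/unif c0 eqxx evX mul1r -E.
move=> /(local_ordM (local_ordV (local_ord_at f10))).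
by rewrite mulKf ?ev_at_neq0 // oppr0 add0r.
Qed.

Lemma local_ord_polyC (g : {poly K}) : g != 0 ->
  exists k, local_ord (ev g%:P) k.
Proof.
move=> g0; have [m [g1]] := multiplicity_XsubC g a; rewrite g0 /= => g1a ->.
have g1P : (g1%:P).[c, a] != 0 by rewrite hornerC.
eexists; rewrite polyCM evM polyC_exp evXn evXsubC.
apply: local_ordM (local_ord_at g1P) (local_ordX _ local_ord_XsubC).
Qed.

(* [unif] can be divided out of [q] only finitely often, since [q] has a      *)
(* nonzero multiple in [K[x]].                                                *)
Lemma local_ord_ev q : ev q != 0 -> exists k, local_ord (ev q) k.
Proof.
move=> q0; have [u [g [g0 Eg]]] := ev_elim d_gt0 q0.
have [M gM] := local_ord_polyC g0.
pose div m := exists r s, s.[c, a] != 0 /\ ev s * ev q = ev unif ^+ m * ev r.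
have divM m : div m -> m%:Z <= M.
  case=> r [s [s0 E]]; have sg := local_ordM (local_ord_at s0) gM.
  have := local_ordM sg (local_ordV (local_ordX m local_ord_unif)).
  rewrite -Eg mulrCA E mulrCA mulrAC divff ?expf_neq0 ?ev_unif_neq0 // !mul1r.
  by rewrite -evM => /local_ord_ge0; rewrite add0r subr_ge0.
have div0 : exists m, `[< div m >].
  exists 0%N; apply/asboolP; exists q, 1; split; last by rewrite rmorph1 expr0.
  by rewrite !hornerE oner_neq0.
have bound m : `[< div m >] -> (m <= absz M)%N by move=> /asboolP/divM; lia.
have [m] := ex_maxnP div0 bound.
move=> /asboolP[r [s [s0 E]]] max; exists m; exists r, s; split=> //;
  last first.
  by rewrite -exprnP -E mulrC.
(* If the cofactor r vanished at (a, c), one more factor [unif] could be extracted, against the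
   maximality of m. *)
apply/eqP=> /at_div_unif[s' [r' [s0' E']]].
have /max : `[< div m.+1 >]; last by rewrite ltnn.
apply/asboolP; exists r', (s' * s); split; first by rewrite !hornerE mulf_neq0.
by rewrite evM -mulrA E mulrCA E' exprSr -mulrA.
Qed.

Lemma local_ord_ex h : h != 0 -> exists k, local_ord h k.
Proof.
move=> h0; have [p [g [g0 E]]] := ev_frac d_gt0 h.
have gC := evC_neq0 C d_gt0 g0.
have [k pk] : exists k, local_ord (ev p) k.
  by apply: local_ord_ev; rewrite -E mulf_neq0.
have [l gl] := local_ord_polyC g0.
by exists (k - l); have := local_ordM pk (local_ordV gl); rewrite -E mulfK.
Qed.

(** Over a common denominator that is a unit, g + h is [unif] to the power k times a polynomial, and
    polynomials have order at least 0. *)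
Lemma local_ordD_le g h k l m : g + h != 0 ->
  local_ord g k -> local_ord h l -> local_ord (g + h) m -> k <= l -> k <= m.
Proof.
move=> gh0 [r [s [r0 s0 E]]] [r' [s' [r0' s0' E']]] ghm kl.
pose n := absz (l - k); have ln : l = k + n by rewrite /n; lia.
have Egh : (g + h) * ev (s * s') =
    ev unif ^ k * ev (r * s' + unif ^+ n * r' * s).
  rewrite ln expfzDr ?ev_unif_neq0 // -exprnP in E'.
  rewrite evD !evM evXn.
  transitivity (g * ev s * ev s' + ev s * (h * ev s')); first by ring.
  rewrite E E'; move: (ev unif ^ k) => T; ring.
have ss0 : (s * s').[c, a] != 0 by rewrite hornerM hornerM mulf_neq0.
have := local_ordM (local_ordM ghm (local_ord_at ss0))
  (local_ordV (local_ord_unifXz k)).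
rewrite Egh mulrAC divff ?expfz_neq0 ?ev_unif_neq0 // mul1r => /local_ord_ge0.
by rewrite addr0 subr_ge0.
Qed.

Lemma affine_point_exists : exists P : point C, is_affine_point P a c.
Proof.
have /choice[o oP] (h : C) : exists k, (h = 0 -> k = 0) /\ (h != 0 -> local_ord
  h k).
  have [h0|/[dup] h0 /local_ord_ex[k hk]] := eqVneq h 0; first by exists 0.
  by exists k; split=> // h0'; rewrite h0' eqxx in h0.
have oE h k : local_ord h k -> o h = k.
  move=> hk; have [_ /(_ (local_ord_neq0 hk)) hk'] := oP h.
  exact: local_ord_uniq hk' hk.
have oL h : h != 0 -> local_ord h (o h) by move=> h0; have [_ /(_ h0)] := oP h.
have o0 : o 0 = 0 by have [/(_ erefl)] := oP 0.
have oM g h : g != 0 -> h != 0 -> o (g * h) = o g + o h.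
  by move=> g0 h0; apply: oE; apply: local_ordM; apply: oL.
have oD g h : g != 0 -> h != 0 -> g + h != 0 -> Num.min (o g) (o h) <= o (g +
  h).
  move=> g0 h0 gh0; have [le|/ltW le] := leP (o g) (o h).
    by apply: (local_ordD_le gh0 _ _ _ le); apply: oL.
  rewrite addrC in gh0 *.
  by apply: (local_ordD_le gh0 _ _ _ le); apply: oL.
have oC b : b != 0 -> o (ff_const C b) = 0.
  by move=> b0; apply: oE; rewrite -evCC; apply: local_ord_at; rewrite !hornerE.
have ou : exists t : C, t != 0 /\ o t = 1.
  by exists (ev unif); split; [exact: ev_unif_neq0 | exact/oE/local_ord_unif].
exists (Point o0 oM oD oC ou); split=> /=.
  by rewrite (oE _ _ local_ord_XsubC); case: ifP => _; lia.
have [c0|c0] := eqVneq c 0.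
  have := local_ord_unif; rewrite /unif c0 eqxx evX rmorph0 subr0.
  by move/oE->.
(* Since s (y - c) = f2 (x - a) with s a unit, the order of y - c is at least the order 1 of x -
   a. *)
have [s [f2 [s0 E]]] := horizontal_tangent c0.
have y0 : ff_y C - ff_const C c != 0.
  rewrite -evYsubC; apply/eqP=> /(ev_eq0 d_gt0);
    rewrite size_XsubC => /(_ d_gt1)/eqP.
  by rewrite polyXsubC_eq0.
have := local_ordM (oL _ y0) (local_ord_at s0).
have [k fk] : exists k, local_ord (ev f2%:P) k.
  have := mulf_neq0 (ev_at_neq0 s0) y0; rewrite E mulf_eq0 negb_or => /andP[+
    _].
  exact: local_ord_ev.
rewrite mulrC E => /local_ord_uniq/(_ (local_ordM fk local_ord_XsubC)).
rewrite (negPf c0); have := local_ord_ge0 fk; lia.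
Qed.

(* The value of a valuation centered at [(a, c)] on [unif] is forced to be 1  *)
(* by the normalization.                                                      *)
Lemma affine_point_ord (P : point C) h k :
  is_affine_point P a c -> local_ord h k -> ord P h = k.
Proof.
case=> ax cy.
have u_gt0 : 0 < ord P (ev unif).
  rewrite /unif; have [c0|_] := eqVneq c 0; last by rewrite evXsubC.
  by move: cy; rewrite evX c0 rmorph0 subr0.
have xge : ord_ge P 0 (ff_x C).
  by rewrite -[ff_x C](subrK (ff_const C a)) ord_geD ?ord_ge_const ?ord_gt0_ge.
have yge : ord_ge P 0 (ff_y C).
  by rewrite -[ff_y C](subrK (ff_const C c)) ord_geD ?ord_ge_const ?ord_gt0_ge.
(* Here r is a nonzero constant plus an element of the maximal ideal of P. *)
have unit r : r.[c, a] != 0 -> ord P (ev r) = 0.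
  move=> r0; have : (r - (r.[c, a])%:P%:P).[c, a] = 0 by rewrite !hornerE subrr.
  case/at_decomp=> u [v Er].
  have Ev : ev r = ff_const C (r.[c, a]) + (ev r - ff_const C (r.[c,
    a])) by rewrite addrC subrK.
  have oc : ord P (ff_const C (r.[c, a])) = 0 by rewrite ord_const.
  have := @ord_ltD _ _ _ C P (ff_const C (r.[c, a])) (ev r - ff_const C (r.[c,
    a])).
  rewrite -Ev oc fmorph_eq0 => /(_ r0)[] //.
  rewrite -evCC -evB Er evD evM polyCM evM evYsubC evXsubC.
  by rewrite ord_geD // ord_geMr ?ev_ge0 // ord_gt0_ge.
have main g l : local_ord g l -> ord P g = ord P (ev unif) * l.
  move=> gl; have g0 := local_ord_neq0 gl; case: gl => r [s [r0 s0]].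
  move/(congr1 (ord P)); rewrite !ordM ?ev_at_neq0 ?expfz_neq0 ?ev_unif_neq0 //.
  by rewrite (unit r) // (unit s) // !addr0 ordXz ?ev_unif_neq0.
have [t [t0 t1]] := ord_uniformizer P.
have [l tl] := local_ord_ex t0.
move/main; suff -> : ord P (ev unif) = 1 by rewrite mul1r.
move: (main _ _ tl) u_gt0; rewrite t1.
move: (ord P (ev unif)) => k1 kl k1_gt0; have l_gt0 : 0 < l by nia.
by nia.
Qed.

End AffinePoint.

(** * Poles of [x]: the point at infinity *)

Section Points.
Variables (K : closedFieldType) (f : {poly K}) (d : nat).
Variable C : function_field f d.
Implicit Types (P Q : point C) (h : C) (g : {poly K}) (p : {poly {poly K}}).
Local Notation ev := (ev C).
Local Notation x := (ff_x C).
Local Notation y := (ff_y C).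
Local Notation cst := (ff_const C).

Lemma point_eq P Q : (forall h, ord P h = ord Q h) -> P = Q.
Proof.
case: P Q => oP P0 PM PD PC Pu [oQ Q0 QM QD QC Qu] /= /funext E.
move: P0 PM PD PC Pu; rewrite E => *; congr Point; exact: Prop_irrelevance.
Qed.

(** This finds residues in K: g splits into linear factors, and if no h - z had positive order then
    neither would their product. *)
Lemma ord_ge_root P h g : ord_ge P 0 h -> g != 0 ->
  ord_ge P 1 (map_poly cst g).[h] ->
  exists2 z, root g z & ord_ge P 1 (h - cst z).
Proof.
move=> h0 g0; have [r Eg] := closed_field_poly_normal g.
have lg : lead_coef g != 0 by rewrite lead_coef_eq0.
have Egh : (map_poly cst g).[h] = cst (lead_coef g) * \prod_(z <- r) (h - cst
  z).
  rewrite [in LHS]Eg map_polyZ hornerZ rmorph_prod horner_prod; congr (_ * _).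
  by apply: eq_bigr => z _; rewrite rmorphB /= map_polyX map_polyC !hornerE.
have [/hasP[z zr hz] _|/hasPn nr] := boolP (has (fun z => ord_ge P 1 (h - cst
  z)) r).
  by exists z => //; rewrite Eg rootZ // root_prod_XsubC.
rewrite Egh => ge1; exfalso; move: ge1; apply/negP.
have : \prod_(z <- r) (h - cst z) != 0 /\ ord P (\prod_(z <- r) (h - cst z)) =
  0.
  rewrite big_seq; apply: (big_ind (fun u => u != 0 /\ ord P u = 0)).
  - by rewrite oner_neq0 Defs.ord1.
  - by move=> u v [u0 ou] [v0 ov]; rewrite mulf_neq0 // ordM // ou ov.
  move=> z /nr; rewrite /ord_ge negb_or => /andP[hz0 hz]; split=> //.
  have : ord_ge P 0 (h - cst z) by rewrite ord_geB ?ord_ge_const.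
  by rewrite ord_geE //; lia.
case=> p0 op; rewrite ord_geE ?mulf_neq0 ?fmorph_eq0 // ordM ?fmorph_eq0 //.
by rewrite op ord_const.
Qed.

Hypothesis d_gt1 : (1 < d)%N.
Let d_gt0 : (0 < d)%N. Proof. exact: ltnW. Qed.

Lemma evXsubC_neq0 a : x - cst a != 0.
Proof. by rewrite -evXsubC evC_neq0 // polyXsubC_eq0. Qed.

Lemma evYsubC_neq0 c : y - cst c != 0.
Proof.
rewrite -evYsubC; apply/eqP=> /(ev_eq0 d_gt0);
  rewrite size_XsubC => /(_ d_gt1)/eqP.
by rewrite polyXsubC_eq0.
Qed.

Lemma ff_x_neq0 : x != 0.
Proof. by have := evXsubC_neq0 0; rewrite rmorph0 subr0. Qed.

Lemma ff_y_neq0 : y != 0.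
Proof. by have := evYsubC_neq0 0; rewrite rmorph0 subr0. Qed.

Hypothesis f_neq0 : f != 0.

Lemma ord_y P : ord P y * d%:Z = ord P (ev f%:P).
Proof. by rewrite -ev_curve ordX ?ff_y_neq0 // -mulr_natr natz. Qed.

(** If x has no pole at P, neither has y. Clearing denominators of a uniformizer and eliminating y
    gives a polynomial in x of positive order, hence a residue a of x; then Y^d - f(a) supplies the
    residue c of y. *)
Lemma affine_or_pole P : ord P x < 0 \/
  exists a c, c ^+ d = f.[a] /\ is_affine_point P a c.
Proof.
have [|x0] := ltrP (ord P x) 0; [by left | right].
have xge : ord_ge P 0 x by rewrite ord_geE ?ff_x_neq0.
have Cge g : ord_ge P 0 (ev g%:P).
  elim/poly_ind: g => [|g c IHg]; first by rewrite !rmorph0 ord_ge0.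
  by rewrite polyCD polyCM evD evM evCX evCC ord_geD ?ord_ge_const // mulrC
    ord_geMr.
have yge : ord_ge P 0 y.
  rewrite ord_geE ?ff_y_neq0 //; have := ord_y P; have := Cge f.
  by rewrite ord_geE ?evC_neq0 //; nia.
have [t [t0 t1]] := ord_uniformizer P.
have [p [g [g0 E]]] := ev_frac d_gt0 t.
have gC := evC_neq0 C d_gt0 g0.
have p0 : ev p != 0 by rewrite -E mulf_neq0.
have p1 : 1 <= ord P (ev p) by rewrite -E ordM // t1; have := Cge g;
  rewrite ord_geE //; lia.
have [u [g' [g'0 E']]] := ev_elim d_gt0 p0.
have : ord_ge P 1 (map_poly cst g').[x].
  by rewrite -ev_polyC -E' ord_geMr ?ev_ge0 // ord_geE.
case/(ord_ge_root xge g'0) => a _ xa.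
have [c] : exists2 c, root ('X^d - (f.[a])%:P) c & ord_ge P 1 (y - cst c).
  apply: ord_ge_root yge _ _; first by rewrite -size_poly_gt0 size_XnsubC.
  have /factor_theorem[f2 Ef] : root (f - (f.[a])%:P) a.
    by rewrite rootE !hornerE subrr.
  rewrite rmorphB /= map_polyXn map_polyC !hornerE ev_curve.
  rewrite (_ : _ - _ = ev (f - (f.[a])%:P)%:P); last by rewrite polyCB evB evCC.
  by rewrite Ef polyCM evM evXsubC ord_geMr.
rewrite rootE !hornerE subr_eq0 => /eqP fac yc.
exists a, c; split=> //; split.
  by move: xa; rewrite ord_geE ?evXsubC_neq0 //; lia.
by move: yc; rewrite ord_geE ?evYsubC_neq0 //; lia.
Qed.

Variable n : nat.
Hypotheses (f_size : size f = n.+1) (nd : coprime n d).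

Section Pole.
Variable P : point C.
Hypothesis x_pole : ord P x < 0.

Lemma pole_polyC g : g != 0 -> ord P (ev g%:P) = ord P x * (size g).-1%:Z.
Proof.
elim/poly_ind: g => [|g c IHg]; first by rewrite eqxx.
move=> gc0; rewrite size_MXaddC polyCD polyCM evD evM evCX evCC.
have [g0|g0] /= := eqVneq g 0.
  rewrite g0 mul0r add0r in gc0 *; move: gc0; rewrite polyC_eq0 => c0.
  by rewrite (negPf c0) rmorph0 mul0r add0r size_poly0 /= mulr0 ord_const.
have gx0 : ev g%:P * x != 0 by rewrite mulf_neq0 ?evC_neq0 ?ff_x_neq0.
have ogx : ord P (ev g%:P * x) = ord P x * (size g)%:Z.
  rewrite ordM ?evC_neq0 ?ff_x_neq0 // IHg // -{2}(mulr1 (ord P x)) -mulrDr.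
  by congr (_ * _); have := size_poly_gt0 g; rewrite g0; lia.
have cge : ord_ge P (ord P (ev g%:P * x) + 1) (cst c).
  apply: ord_ge_trans (ord_ge_const P c); rewrite ogx.
  by have := size_poly_gt0 g; rewrite g0; nia.
by have [_ ->] := ord_ltD gx0 cge.
Qed.

(** From d ord(y) = n ord(x) and coprimality. That e = 1 must wait for [pole_ord], which needs the
    orders of all functions. *)
Lemma pole_xy : exists2 e : nat, (0 < e)%N &
  ord P x = - (e * d)%:Z /\ ord P y = - (e * n)%:Z.
Proof.
have := ord_y P; rewrite pole_polyC // f_size /= => E.
have /dvdzP[k Ek] : (d%:Z %| ord P x)%Z.
  by rewrite -(@Gauss_dvdzl _ _ n%:Z) ?coprimezE ?absz_nat 1?coprime_sym // -E
    dvdz_mull.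
have d0 : d%:Z != 0 by rewrite -lt0n.
have k_lt0 : k < 0 by move: x_pole; rewrite Ek; nia.
exists (absz k); first by lia.
split; first by rewrite Ek PoszM; nia.
apply: (mulIf d0); rewrite E Ek PoszM; nia.
Qed.

End Pole.

(* At infinity [x] and [y] have poles of order [d] and [n], so the terms of   *)
(* [p], if fewer than [d], have pole orders that are distinct modulo [d].     *)
Definition pole_wt (p : {poly {poly K}}) i := (d * (size (p`_i)%R).-1 + n *
  i)%N.
Definition pole_order (p : {poly {poly K}}) :=
  (\max_(i < size p | (p`_i != 0)%R) pole_wt p i)%N.

Lemma pole_wt_inj p i j : (i < d)%N -> (j < d)%N ->
  pole_wt p i = pole_wt p j -> i = j.
Proof.
wlog ij : i j / (i <= j)%N.
  by move=> W id jd E; have [/W->|/ltnW/W->] := leqP i j.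
rewrite /pole_wt => id jd E.
have dvd : (d %| n * (j - i))%N.
  have -> : (n * (j - i) = d * (size (p`_i)%R).-1 - d * (size (p`_j)%R).-1)%N
    by nia.
  by rewrite -mulnBr dvdn_mulr.
rewrite Gauss_dvdr 1?coprime_sym // in dvd.
case: (posnP (j - i)) => [|/dvdn_leq/(_ dvd)]; lia.
Qed.

Lemma pole_wt_le p i : p`_i != 0 -> (pole_wt p i <= pole_order p)%N.
Proof.
move=> pi0; have ip : (i < size p)%N.
  by rewrite ltnNge; apply: contra_neqN pi0 => /(nth_default 0).
exact: (@leq_bigmax_cond _ _ (fun i : 'I_(size p) => pole_wt p i) (Ordinal ip)).
Qed.

Lemma pole_order_eq p : p != 0 ->
  exists2 i : 'I_(size p), p`_i != 0 & pole_order p = pole_wt p i.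
Proof.
move=> p0; have ltl : ((size p).-1 < size p)%N by rewrite prednK //
  size_poly_gt0.
have card : (0 < #|[pred i : 'I_(size p) | p`_i != 0]%R|)%N.
  by apply/card_gt0P; exists (Ordinal ltl);
    rewrite inE /= -lead_coefE lead_coef_eq0.
have [i pi0 E] := eq_bigmax_cond (fun i : 'I_(size p) => pole_wt p i) card.
by exists i.
Qed.

Lemma ev_sum p : ev p = \sum_(i < size p) ev (p`_i)%:P * y ^+ i.
Proof.
rewrite -[p in LHS]coefK poly_def rmorph_sum /=; apply: eq_bigr => i _.
by rewrite -mul_polyC evM evXn evX.
Qed.

Lemma pole_ord_ev P e p : p != 0 -> (size p <= d)%N -> (0 < e)%N ->
  ord P x = - (e * d)%:Z -> ord P y = - (e * n)%:Z ->
  ord P (ev p) = - (e * pole_order p)%:Z.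
Proof.
move=> p0 sp e0 ox oy.
have x_pole : ord P x < 0 by rewrite ox; nia.
have term i : p`_i != 0 -> ev (p`_i)%:P * y ^+ i != 0 /\
    ord P (ev (p`_i)%:P * y ^+ i) = - (e * pole_wt p i)%:Z.
  move=> pi0; rewrite mulf_neq0 ?expf_neq0 ?ff_y_neq0 ?evC_neq0 //; split=> //.
  rewrite ordM ?expf_neq0 ?ff_y_neq0 ?evC_neq0 // ordX ?ff_y_neq0 //.
  by rewrite pole_polyC // ox oy -mulr_natr natz /pole_wt; nia.
have [i0 pi0 Emax] := pole_order_eq p0.
have [t0 ot] := term _ pi0.
rewrite Emax -ot ev_sum (bigD1 i0) //=.
apply: (proj2 (ord_ltD t0 _)); apply: ord_ge_sum => i _ ii0.
have [pi_0|pi_0] := eqVneq p`_i 0; first by rewrite pi_0 rmorph0 mul0r ord_ge0.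
have [ti0 oti] := term _ pi_0.
rewrite ord_geE // oti ot.
have le : (pole_wt p i <= pole_wt p i0)%N.
  by rewrite -Emax pole_wt_le.
have ne : pole_wt p i != pole_wt p i0.
  apply: contra_neq ii0 => E; apply: val_inj.
  by apply: pole_wt_inj E; apply: leq_trans sp.
have : (pole_wt p i < pole_wt p i0)%N by rewrite ltn_neqAle ne.
by nia.
Qed.

(** By [pole_ord_ev] every order at P is a multiple of e, and a uniformizer has order 1. *)
Lemma pole_ord P : ord P x < 0 -> ord P x = - d%:Z /\ ord P y = - n%:Z.
Proof.
move=> x_pole; have [e e0 [ox oy]] := pole_xy x_pole.
suff e1 : e = 1%N by rewrite ox oy e1 !mul1n.
have [t [t0 t1]] := ord_uniformizer P.
have [p [g [g0 E]]] := ev_frac d_gt0 t.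
have [q sq Eq] := ev_rep C d_gt0 p.
have gC := evC_neq0 C d_gt0 g0.
have q0 : q != 0.
  by apply: contra_neq (mulf_neq0 t0 gC) => q0; rewrite E Eq q0 rmorph0.
move/(congr1 (ord P)): E; rewrite Eq (pole_ord_ev q0 sq e0 ox oy).
rewrite ordM // t1 pole_polyC // ox.
move: (pole_order q) (size g).-1 => k l E.
have : (e %| 1)%N.
  have -> : 1%N = (e * (d * l) - e * k)%N by nia.
  by rewrite -mulnBr dvdn_mulr.
by rewrite dvdn1 => /eqP.
Qed.

Lemma pole_ord_poly P p : ord P x < 0 -> p != 0 -> (size p <= d)%N ->
  ord P (ev p) = - (pole_order p)%:Z.
Proof.
move=> /pole_ord[ox oy] p0 sp.
by rewrite (@pole_ord_ev _ 1) ?mul1n.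
Qed.

(** Writing h as q / g in normal form, its order is the same expression in q and g at every pole of
    x. *)
Lemma pole_unique P Q : ord P x < 0 -> ord Q x < 0 -> P = Q.
Proof.
move=> Px Qx; apply: point_eq => h.
have [->|h0] := eqVneq h 0; first by rewrite !Defs.ord0.
have [p [g [g0 E]]] := ev_frac d_gt0 h.
have [q sq Eq] := ev_rep C d_gt0 p.
have gC := evC_neq0 C d_gt0 g0.
have q0 : q != 0.
  by apply: contra_neq (mulf_neq0 h0 gC) => q0; rewrite E Eq q0 rmorph0.
have oE R : ord R x < 0 -> ord R h = - (pole_order q)%:Z + (d * (size g).-1)%:Z.
  move=> Rx; rewrite -(pole_ord_poly Rx q0 sq) -Eq -E ordM // pole_polyC //.
  by have [-> _] := pole_ord Rx; rewrite PoszM mulNr subrK.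
by rewrite !oE.
Qed.

End Points.

(** * Functions regular on the affine curve, and the jacobian *)

Section Curve.
Variables (K : closedFieldType) (f : {poly K}) (d : nat).
Variable C : function_field f d.
Hypotheses (d_gt1 : (1 < d)%N) (dK : d%:R != 0 :> K) (f_sep : separable_poly f).
Implicit Types (P Q : point C) (h : C) (g v : {poly K}) (p : {poly {poly K}})
  (a b c : K).
Local Notation ev := (ev C).
Local Notation x := (ff_x C).
Local Notation y := (ff_y C).
Local Notation cst := (ff_const C).

Let d_gt0 : (0 < d)%N. Proof. exact: ltnW. Qed.

Lemma affine_point_inj P a c a' c' :
  is_affine_point P a c -> is_affine_point P a' c' -> a = a' /\ c = c'.
Proof.
case=> ax cy [ax' cy']; split.
  by apply/eqP/negP=> /negP aa'; have [_ E] := ord_sub_const ax' aa';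
    rewrite E in ax.
by apply/eqP/negP=> /negP cc'; have [_ E] := ord_sub_const cy' cc';
  rewrite E in cy.
Qed.

Section AtPoint.
Variables (P : point C) (a c : K).
Hypotheses (fac : c ^+ d = f.[a]) (Pac : is_affine_point P a c).

Lemma affine_ord_XsubC : ord P (x - cst a) = if c == 0 then d%:Z else 1.
Proof. exact: (affine_point_ord d_gt1 dK f_sep fac Pac (local_ord_XsubC _ _ _
  _)). Qed.

Lemma affine_ord_unit p : p.[c, a] != 0 -> ord P (ev p) = 0.
Proof.
by move=> p0; apply: (affine_point_ord d_gt1 dK f_sep fac Pac (local_ord_at C
  p0)).
Qed.

Lemma affine_ord_y : c = 0 -> ord P y = 1.
Proof.
move=> c0; have := affine_point_ord d_gt1 dK f_sep fac Pac (local_ord_unif C a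
  c).
by rewrite /unif c0 eqxx evX.
Qed.

Lemma affine_ord_ge0 p : ord_ge P 0 (ev p).
Proof.
have [->|p0] := eqVneq (ev p) 0; first exact: ord_ge0.
have [k kp] := local_ord_ev d_gt1 dK f_sep fac p0.
rewrite ord_geE // (affine_point_ord d_gt1 dK f_sep fac Pac kp).
exact: local_ord_ge0 kp.
Qed.

Lemma affine_zero p : ord_ge P 1 (ev p) -> p.[c, a] = 0.
Proof.
move=> p1; apply/eqP/negP=> /negP p0; move: p1.
by rewrite ord_geE ?(ev_at_neq0 C fac) // affine_ord_unit.
Qed.

Lemma affine_vanish p : p.[c, a] = 0 -> ord_ge P 1 (ev p).
Proof.
move=> /at_decomp[u [v ->]]; have [ax cy] := Pac.
by rewrite evD evM polyCM evM evYsubC evXsubC ord_geD // ord_geMr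
  ?affine_ord_ge0 // ord_gt0_ge.
Qed.

Lemma affine_point_unique Q : is_affine_point Q a c -> Q = P.
Proof.
move=> Qac; apply: point_eq => h.
have [->|h0] := eqVneq h 0; first by rewrite !Defs.ord0.
have [k hk] := local_ord_ex d_gt1 dK f_sep fac h0.
by rewrite !(affine_point_ord d_gt1 dK f_sep fac _ hk).
Qed.

End AtPoint.

(** * Fibers of x, and functions regular on the affine curve *)

Lemma dth_roots (b : K) : b != 0 ->
  exists r : seq K, [/\ uniq r, size r = d & forall z, z \in r -> z ^+ d = b].
Proof.
move=> b0; have [r Er] := closed_field_poly_normal ('X^d - b%:P).
rewrite (monicP (monicXnsubC b d_gt0)) scale1r in Er.
exists r; split.
- rewrite -separable_prod_XsubC -Er unlock; apply/Bezout_coprimepP.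
  (* The Bezout relation -(Y^d - b) / b + (Y / (b d)) (d Y^(d-1)) = 1 shows separability. *)
  exists ((- b^-1)%:P, ((b * d%:R)^-1)%:P * 'X).
  have -> : deriv ('X^d - b%:P) = (d%:R)%:P * 'X^(d.-1).
    by rewrite derivB derivXn derivC subr0 polyC_natr mulr_natl.
  have /= -> : ((b * d%:R)^-1)%:P * 'X * ((d%:R)%:P * 'X^(d.-1)) =
      (b^-1)%:P * 'X^d :> {poly K}.
    by rewrite mulrACA -polyCM -exprS prednK // invfM -mulrA mulVf // mulr1.
  rewrite mulrBr -polyCM mulNr mulVf // !polyCN polyC1 mulNr opprK addrAC addNr
    add0r.
  exact: eqpxx.
- by have := size_XnsubC b d_gt0; rewrite Er size_prod_XsubC => -[].
by move=> z; rewrite -root_prod_XsubC -Er rootE !hornerE subr_eq0 => /eqP.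
Qed.

(* If [f b <> 0], then [p(b, Y)] vanishes at the [d] roots of [Y^d - f b].    *)
(* Otherwise a single point lies over [b]; there [y] has order 1 and [x - b]  *)
(* order [d], so the coefficients of [p] can be treated by increasing index.  *)
Lemma fiber_div p b : (size p <= d)%N ->
  (forall c P, c ^+ d = f.[b] -> is_affine_point P b c ->
     ord_ge P (ord P (x - cst b)) (ev p)) ->
  forall i, root p`_i b.
Proof.
move=> sp van; have [fb0|fb0] := eqVneq f.[b] 0; last first.
  have [r [r_uniq r_size rP]] := dth_roots fb0.
  suff q0 : map_poly (horner_eval b) p = 0.
    by move=> i; rewrite rootE -[_.[b]](coef_map (horner_eval b)) q0 coef0.
  apply/eqP/negP=> /negP /max_poly_roots/(_ _ r_uniq) lt.
  have : (size r < size (map_poly (horner_eval b) p))%N.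
    apply: lt; apply/allP=> c cr.
    have fbc := rP c cr; have [P Pbc] := affine_point_exists C d_gt1 dK f_sep
      fbc.
    have c0 : c != 0 by apply: contra_neq fb0 => c0;
      rewrite -fbc c0 expr0n gtn_eqF.
    have := van _ _ fbc Pbc; rewrite (affine_ord_XsubC fbc Pbc) (negPf c0).
    move/(affine_zero fbc Pbc) => pc0.
    have := horner_map (horner_eval b) p c%:P.
    by rewrite /= /horner_eval hornerC pc0 => /rootP.
  by rewrite r_size ltnNge (leq_trans (size_poly _ _) sp).
have f0b : 0 ^+ d = f.[b] by rewrite fb0 expr0n gtn_eqF.
have [P Pb] := affine_point_exists C d_gt1 dK f_sep f0b.
have xd : ord P (x - cst b) = d by rewrite (affine_ord_XsubC f0b Pb) eqxx.
have pd : ord_ge P d (ev p) by rewrite -xd; apply: van f0b Pb.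
have y1 : ord P y = 1 := affine_ord_y f0b Pb erefl.
move=> i; elim/ltn_ind: i => i IH.
have [id|di] := leqP d i; first by rewrite nth_default ?root0 // (leq_trans sp).
(* The coefficients below i are divisible by x - b, so these terms have order at least d. The
   remaining part y^i (p_i + ...) then has order at least d > i, which forces its second factor to
   vanish at (b, 0). *)
have lowd : ord_ge P d (ev (take_poly i p)).
  rewrite /take_poly poly_def rmorph_sum /=; apply: ord_ge_sum => j _ _.
  have /factor_theorem[q ->] := IH j (ltn_ord j).
  rewrite -mul_polyC mulrC polyCM !evM evXsubC mulrA ord_geMr //.
    by rewrite -evM; apply: affine_ord_ge0 f0b Pb _.
  by rewrite ord_geE ?evXsubC_neq0 // xd.
have : ord_ge P d (ev (drop_poly i p) * y ^+ i).
  rewrite -evX -evXn -evM -[_ * _](addKr (take_poly i p)) poly_take_drop addrC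
    evB.
  exact: ord_geB.
have [drop0|drop0] := eqVneq (ev (drop_poly i p)) 0.
  move=> _; have : ord_ge P 1 (ev (drop_poly i p)) by rewrite drop0 ord_ge0.
  by move/(affine_zero f0b Pb); rewrite horner_coef0 coef_drop_poly add0n =>
    /rootP.
rewrite ord_geE ?mulf_neq0 ?expf_neq0 ?ff_y_neq0 // ordM ?expf_neq0 ?ff_y_neq0
  //.
rewrite ordX ?ff_y_neq0 // y1 => le.
have : ord_ge P 1 (ev (drop_poly i p)) by rewrite ord_geE //; lia.
by move/(affine_zero f0b Pb); rewrite horner_coef0 coef_drop_poly add0n =>
  /rootP.
Qed.

(** Descent on the degree of a denominator g in K[x]: at a root b of g, regularity of h makes the
    numerator h g vanish on the fiber over b as much as x - b does, so by [fiber_div] the factor x -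
    b cancels. *)
Lemma regular_ev h :
  (forall a c P, c ^+ d = f.[a] -> is_affine_point P a c -> ord_ge P 0 h) ->
  exists2 p : {poly {poly K}}, (size p <= d)%N & h = ev p.
Proof.
move=> h_reg; have [p0 [g [g0 E0]]] := ev_frac d_gt0 h.
have [p sp Ep] := ev_rep C d_gt0 p0; rewrite {p0}Ep in E0.
move: {2}(size g) (leqnn (size g)) => s sg.
elim: s => [|s IH] in g g0 p sp E0 sg *.
  by move: sg; rewrite leqn0 size_poly_eq0 (negPf g0).
have [/eqP|/closed_rootP[b /factor_theorem[g1 Eg]]] := boolP (size g == 1%N).
  move=> /eqP/size_poly1P[b b0 Eg]; exists ((b^-1)%:P *: p).
    by rewrite size_scale // polyC_eq0 invr_eq0.
  rewrite -mul_polyC evM -E0 Eg !evCC mulrC -mulrA -rmorphM divff //.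
  by rewrite rmorph1 mulr1.
have g10 : g1 != 0 by apply: contra_neq g0 => g10; rewrite Eg g10 mul0r.
pose p' : {poly {poly K}} := \poly_(i < d) (p`_i %/ ('X - b%:P)).
have pdiv : forall i, root p`_i b.
  apply: fiber_div sp _ => c P fbc Pbc; rewrite -E0 Eg polyCM evM evXsubC mulrA.
  rewrite -[ord P _]add0r ord_geM ?ord_ge_refl // ord_geMr ?(h_reg _ _ _ fbc
    Pbc) //.
    exact: affine_ord_ge0 fbc Pbc _.
have Ep : p = ('X - b%:P)%:P * p'.
  apply/polyP=> i; rewrite coefCM coef_poly; case: ltnP => id.
    by rewrite mulrC divpK // dvdp_XsubCl pdiv.
  by rewrite mulr0 nth_default // (leq_trans sp).
apply: (IH g1 g10 p' (size_poly _ _)).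
  apply: (mulIf (evXsubC_neq0 C d_gt1 b)).
  by rewrite -mulrA -evXsubC -!evM -polyCM -Eg E0 mulrC -Ep.
by move: sg; rewrite Eg size_mul ?polyXsubC_eq0 // size_XsubC addn2.
Qed.

(** * Multiples of a point in the jacobian *)

Variable n : nat.
Hypotheses (f_size : size f = n.+1) (nd : coprime n d).
Variable inf : point C.
Hypothesis inf_inf : is_infinity inf.

Let f_neq0 : f != 0. Proof. by rewrite -size_poly_gt0 f_size. Qed.
Let n_gt0 : (0 < n)%N.
Proof. by case: n nd d_gt1 => // ; rewrite /coprime gcd0n => /eqP->. Qed.
Let d_ndvd_n : ~~ (d %| n)%N.
Proof.
by apply/negP=> dn; move: nd d_gt1; rewrite /coprime (gcdn_idPr dn) => /eqP->.
Qed.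

Lemma inf_pole : ord inf x < 0.
Proof.
by have [|[a [c [_ /inf_inf]]]] := affine_or_pole d_gt1 f_neq0 inf.
Qed.

Lemma affine_or_inf P : P = inf \/ exists a c,
  c ^+ d = f.[a] /\ is_affine_point P a c.
Proof.
have [Pp|] := affine_or_pole d_gt1 f_neq0 P; last by right.
by left; apply: pole_unique d_gt1 f_neq0 _ f_size nd _ _ Pp inf_pole.
Qed.

Definition div_multiple P m h :=
  h != 0 /\ forall Q, ord Q h = ((Q == P)%:Z - (Q == inf)%:Z) * m%:Z.

Lemma jacobian_eq0 P m :
  to_jacobian inf P *+ m = 0 <-> exists h, div_multiple P m h.
Proof.
have coeffE Q : coeff Q (div0_val (Div0 (deg0_sub P inf) *+ m)) =
    ((Q == P)%:Z - (Q == inf)%:Z) * m%:Z.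
  have -> : div0_val (Div0 (deg0_sub P inf) *+ m) = (<<P>> - <<inf>>) *+ m.
    exact: (raddfMn (val : div0 C -> _)).
  rewrite raddfMn /= coeffB !coeffU !mul1r.
  by rewrite -[LHS]mulr_natr !natz !(eq_sym Q).
have -> : to_jacobian inf P *+ m =
    (\pi_(jacobian C) (Div0 (deg0_sub P inf) *+ m))%qT.
  by rewrite raddfMn.
have -> : 0 = (\pi_(jacobian C) 0)%qT by rewrite raddf0.
split.
  move/eqP; rewrite -Quotient.idealrBE subr0 => /asboolP[h [h0 hE]].
  by exists h; split=> // Q; rewrite -hE coeffE.
case=> h [h0 hE]; apply/eqP; rewrite -Quotient.idealrBE subr0.
by apply/asboolP; exists h; split=> // Q; rewrite hE coeffE.
Qed.

Lemma affine_neq_inf Q a c : is_affine_point Q a c -> (Q == inf) = false.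
Proof. by move=> Qac; apply/eqP=> E; apply: (inf_inf (a := a) (c := c));
  rewrite -E. Qed.

Lemma multiple_zero P m h Q a c : div_multiple P m h ->
  is_affine_point Q a c -> ord_ge Q 1 h -> Q = P.
Proof.
case=> h0 hE Qac; rewrite ord_geE // hE (affine_neq_inf Qac) subr0.
by case: eqP => // _; rewrite mul0r.
Qed.

(** Infinity is the only possible pole of h, so [regular_ev] applies, and the coefficient -m of the
    divisor there is minus the pole order. *)
Lemma multiple_poly P m h : P != inf -> div_multiple P m h ->
  exists p, [/\ p != 0, (size p <= d)%N, h = ev p & pole_order d n p = m].
Proof.
move=> Pinf [h0 hE]; have [|p sp Ep] := @regular_ev h.
  move=> a c Q _ Qac; rewrite ord_geE // hE (affine_neq_inf Qac) subr0.
  by rewrite mulr_ge0.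
have p0 : p != 0 by apply: contra_neq h0 => p0; rewrite Ep p0 rmorph0.
exists p; split=> //; have := hE inf; rewrite eqxx eq_sym (negPf Pinf) sub0r
  mulN1r Ep.
by rewrite (pole_ord_poly d_gt1 f_neq0 f_size nd inf_pole p0 sp) => /oppr_inj[].
Qed.

Lemma other_dth_root c : c != 0 -> exists2 c', c' != c & c' ^+ d = c ^+ d.
Proof.
move=> c0; have [r [r_uniq r_size rP]] := dth_roots (expf_neq0 d c0).
have /allPn[c' c'r c'c] : ~~ all (pred1 c) r.
  apply/negP=> /allP rc; have : (size r <= size [:: c])%N.
    by apply: uniq_leq_size => // z /rc /= /eqP->; rewrite inE.
  by rewrite r_size leqNgt d_gt1.
by exists c' => //; apply: rP.
Qed.

Lemma multiple_lt_n P a c m : c ^+ d = f.[a] -> is_affine_point P a c ->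
  (0 < m < n)%N -> to_jacobian inf P *+ m = 0 -> (d %| m)%N /\ c = 0.
Proof.
move=> fac Pac /andP[m_gt0 mn] /jacobian_eq0[h hP].
have Pinf : P != inf by rewrite (affine_neq_inf Pac).
have [p [p0 sp Eh Em]] := multiple_poly Pinf hP.
have [i pi0 Ei] := pole_order_eq d n p0.
(* A term of positive index has weight at least n > m, so h is a polynomial in x alone. *)
have pj0 j : (0 < j)%N -> p`_j = 0.
  move=> j0; apply/eqP; apply/negPn/negP=> /(pole_wt_le d n).
  by rewrite Em /pole_wt; nia.
have i0 : (i : nat) = 0%N.
  by apply/eqP; rewrite -leqn0 leqNgt; apply: contra_neqN pi0 => /pj0.
have Ep : p = (p`_0)%:P.
  by apply/polyP=> -[|j]; rewrite coefC //= pj0.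
rewrite Em /pole_wt i0 muln0 addn0 in Ei.
split; first by rewrite Ei dvdn_mulr.
have /closed_rootP[b pb] : size (p`_0)%R != 1%N.
  by apply: contraTneq m_gt0 => s1; rewrite Ei s1 muln0.
(* h vanishes at every point over its root b, while P is its only affine zero. So b = a, and a
   nonzero c would give a second point through another d-th root. *)
have over_b c' Q : c' ^+ d = f.[b] -> is_affine_point Q b c' -> Q = P.
  move=> fbc Qbc; apply: (multiple_zero hP Qbc).
  by rewrite Eh (affine_vanish fbc Qbc) // Ep hornerC (rootP pb).
have /closed_rootP[c1] : size ('X^d - (f.[b])%:P) != 1%N.
  by rewrite size_XnsubC // eqSS -lt0n.
rewrite rootE !hornerE subr_eq0 => /eqP fbc1.
have [Q1 Q1P] := affine_point_exists C d_gt1 dK f_sep fbc1.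
have EQ1 := over_b _ _ fbc1 Q1P; rewrite {}EQ1 in Q1P.
have [ab cc1] := affine_point_inj Pac Q1P;
  rewrite -{}cc1 -{}ab in Q1P fbc1 over_b.
have [//|c0] := eqVneq c 0; have [c' c'c fac'] := other_dth_root c0.
rewrite fac in fac'; have [Q Qac'] := affine_point_exists C d_gt1 dK f_sep fac'.
have EQ := over_b _ _ fac' Qac'; rewrite {}EQ in Qac'.
by have [_ E] := affine_point_inj Pac Qac'; rewrite E eqxx in c'c.
Qed.

Lemma ramified_multiple P a : f.[a] = 0 -> is_affine_point P a 0 ->
  to_jacobian inf P *+ d = 0.
Proof.
move=> fa0 Pa; have f0a : 0 ^+ d = f.[a] by rewrite fa0 expr0n gtn_eqF.
apply/jacobian_eq0; exists (x - cst a); split; first exact: evXsubC_neq0.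
move=> Q; have [->|[b [c [fbc Qbc]]]] := affine_or_inf Q.
  rewrite eqxx eq_sym (affine_neq_inf Pa) sub0r mulN1r -evXsubC.
  rewrite (pole_polyC d_gt1 f_neq0 f_size nd inf_pole) ?polyXsubC_eq0 //
    size_XsubC.
  by have [-> _] := pole_ord d_gt1 f_neq0 f_size nd inf_pole; rewrite mulr1.
rewrite (affine_neq_inf Qbc) subr0; have [ab|ab] := eqVneq a b.
  rewrite -ab in fbc Qbc; have c0 : c = 0.
    by move/eqP: fbc; rewrite fa0 expf_eq0 d_gt0 => /eqP.
  rewrite c0 in Qbc; rewrite (affine_point_unique f0a Pa Qbc) eqxx mul1r.
  by rewrite (affine_ord_XsubC f0a Pa) eqxx.
have [_ ->] := ord_sub_const (proj1 Qbc) ab.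
have /negPf-> : Q != P; last by rewrite mul0r.
apply: contra_neq ab => QP; rewrite QP in Qbc.
by have [] := affine_point_inj Pa Qbc.
Qed.

Lemma monic_single_root g a : g \is monic -> (forall b, root g b -> b = a) ->
  g = ('X - a%:P) ^+ (size g).-1.
Proof.
move=> g_monic ga; have [r Er] := closed_field_poly_normal g.
rewrite (monicP g_monic) scale1r in Er.
have ra : all (pred1 a) r.
  by apply/allP=> z zr /=; rewrite [z]ga // Er root_prod_XsubC.
have -> : (size g).-1 = size r by rewrite Er size_prod_XsubC.
by rewrite [LHS]Er (all_pred1P _ _ ra) big_nseq -Monoid.iteropE size_nseq.
Qed.

Lemma order_n_power P a c : c ^+ d = f.[a] -> is_affine_point P a c ->
  f \is monic -> to_jacobian inf P *+ n = 0 ->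
  exists v : {poly K}, (d * (size v).-1 <= n - 1)%N /\ f = ('X - a%:P) ^+ n + v
    ^+ d.
Proof.
move=> fac Pac f_monic /jacobian_eq0[h hP].
have Pinf : P != inf by rewrite (affine_neq_inf Pac).
have [p [p0 sp Eh Em]] := multiple_poly Pinf hP.
have wt_neq k : (d * k != n)%N by apply: contra d_ndvd_n => /eqP<-;
  apply: dvdn_mulr.
have [i pi0 Ei] := pole_order_eq d n p0.
rewrite Em /pole_wt in Ei.
(* The dominant weight is n: index 0 would make d divide n, and an index of 2 or more gives weight
   at least 2n. *)
have i1 : (i : nat) = 1%N.
  case: (i : nat) Ei => [|[|j]] //; last by nia.
  by rewrite muln0 addn0 => /esym/eqP; rewrite (negPf (wt_neq _)).
rewrite i1 in pi0 Ei.
have s1 : size (p`_1)%R = 1%N by move: pi0; rewrite -size_poly_gt0; nia.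
have pj0 j : (1 < j)%N -> p`_j = 0.
  move=> j1; apply/eqP; apply/negPn/negP=> /(pole_wt_le d n).
  by rewrite Em /pole_wt; nia.
have wt0 : (d * (size (p`_0)%R).-1 <= n - 1)%N.
  have [->|pn0] := eqVneq p`_0 0; first by rewrite size_poly0 muln0.
  have := pole_wt_le d n pn0; rewrite Em /pole_wt muln0 addn0 => le.
  by rewrite subn1 -ltnS prednK // ltn_neqAle wt_neq.
have /size_poly1P[u u0 Eu] : size (p`_1)%R == 1%N by apply/eqP.
(* Chosen so that p = u (Y - v). *)
pose v := - u^-1 *: p`_0.
have sv : size v = size (p`_0)%R by rewrite size_scale ?oppr_eq0 ?invr_eq0.
have Ep : p = (p`_0)%:P + u%:P%:P * 'X.
  apply/polyP=> -[|[|j]]; rewrite coefD coefC coefMX coefC /= ?addr0 ?add0r //.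
  exact: pj0.
have svd : (size (v ^+ d) <= n)%N.
  apply: leq_trans (size_exp_leq _ _) _; rewrite sv mulnC.
  by move: wt0; rewrite subn1 -ltnS prednK.
exists v; split; first by rewrite sv.
have sg : size (f - v ^+ d) = n.+1 by rewrite size_polyDl ?size_polyN ?f_size.
have g_monic : f - v ^+ d \is monic.
  by rewrite monicE lead_coefDl ?size_polyN ?f_size.
rewrite -[n]/n.+1.-1 -sg -(monic_single_root g_monic) ?subrK // => b.
rewrite rootE !hornerE subr_eq0 => /eqP fb.
(* A root b of f - v^d gives the affine zero (b, v(b)) of h, which must be P. *)
have fvb : v.[b] ^+ d = f.[b] by rewrite fb hornerE.
have [Q Qb] := affine_point_exists C d_gt1 dK f_sep fvb.
have QP : Q = P.
  apply: (multiple_zero hP Qb); rewrite Eh (affine_vanish fvb Qb) //.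
  have -> : p.[v.[b], b] = (p`_0).[b] + u * v.[b].
    by rewrite [in LHS]Ep !hornerE.
  by rewrite /v hornerZ mulrA mulrN divff // mulN1r subrr.
rewrite QP in Qb; by have [] := affine_point_inj Pac Qb.
Qed.

(** If c = 0 then v(a) = 0, and since n and d are at least 2, a is a multiple root of f. *)
Lemma order_n_point_neq0 a c v : c ^+ d = f.[a] ->
  f = ('X - a%:P) ^+ n + v ^+ d -> (1 < n)%N -> c != 0.
Proof.
move=> fac Ef n_gt1; apply/eqP=> c0.
have va : v.[a] = 0.
  move: fac; rewrite c0 Ef !hornerE subrr !expr0n !gtn_eqF // add0r =>
    /esym/eqP.
  by rewrite expf_eq0 d_gt0 => /eqP.
have /factor_theorem[v1 Ev] : root v a by apply/rootP.
move: f_sep; rewrite Ef Ev exprMn -(prednK n_gt0) -(prednK d_gt0) !exprSr mulrA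
  -mulrDl.
rewrite separable_root => /andP[_]; rewrite rootE !hornerE subrr !expr0n.
rewrite !gtn_eqF ?mulr0 ?add0r ?eqxx //; lia.
Qed.

Lemma power_order_n P a c v : c ^+ d = f.[a] -> is_affine_point P a c ->
  (d * (size v).-1 <= n - 1)%N -> f = ('X - a%:P) ^+ n + v ^+ d -> v.[a] = c ->
  c != 0 -> to_jacobian inf P *+ n = 0.
Proof.
move=> fac Pac sv Ef va c0; pose p : {poly {poly K}} := 'X - v%:P.
have sp : size p = 2%N by rewrite size_XsubC.
have p0 : p != 0 by rewrite -size_poly_gt0 sp.
have ep0 : ev p != 0 by apply: contra_neq p0 => /(ev_eq0 d_gt0) ->; rewrite ?sp.
have pE b c' : p.[c', b] = c' - v.[b] by rewrite !hornerE.
apply/jacobian_eq0; exists (ev p); split=> // Q.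
have [->|[b [c' [fbc Qbc]]]] := affine_or_inf Q.
  rewrite eqxx eq_sym (affine_neq_inf Pac) sub0r mulN1r.
  rewrite (pole_ord_poly d_gt1 f_neq0 f_size nd inf_pole p0) ?sp //;
    congr (- (Posz _)).
  have p1 : p`_1 = 1 by rewrite coefB coefX coefC subr0.
  apply/eqP; rewrite eqn_leq; apply/andP; split; last first.
    have := pole_wt_le d n (_ : p`_1 != 0); rewrite p1 oner_neq0 => /(_ isT).
    by rewrite /pole_wt p1 size_poly1 muln0 muln1.
  have [[i ip] pi0 ->] := pole_order_eq d n p0; rewrite /pole_wt /=.
  case: i ip pi0 => [|[|i]] /= ip _; last by rewrite sp in ip.
    by rewrite coefB coefX coefC sub0r size_polyN muln0 addn0 (leq_trans sv)
      ?leq_subr.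
  by rewrite p1 size_poly1 muln0 muln1.
rewrite (affine_neq_inf Qbc) subr0; case: eqP => [QP|/eqP QP]; last first.
  (* An affine zero (b, v(b)) of y - v satisfies (b - a)^n = 0, so it is (a, v(a)), that is, P. *)
  rewrite mul0r (affine_ord_unit fbc Qbc) // pE // subr_eq0.
  apply: contra_neq QP => vb; have ba : b = a.
    move: fbc; rewrite vb Ef !hornerE -[LHS]add0r => /addIr/esym/eqP.
    by rewrite expf_eq0 n_gt0 subr_eq0 => /eqP.
  rewrite vb ba va in Qbc fbc.
  exact: (affine_point_unique fac Pac Qbc).
(* On the curve S (y - v) = y^d - v^d = (x - a)^n. At P the factor S takes the nonzero value d
   c^(d-1) and x - a has order 1, so y - v has order n. *)
rewrite mul1r QP; have /factor_theorem[S ES] : root ('X^d - (v ^+ d)%:P) v.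
  by rewrite rootE !hornerE subrr.
have S0 : S.[c, a] != 0.
  move/(congr1 deriv)/(congr1 (horner^~ c%:P))/(congr1 (horner^~ a)): ES.
  rewrite derivB derivC derivXn derivM derivXsubC !hornerE va subrr mulr0 add0r.
  move=> <-; rewrite hornerMn !hornerE -polyC_exp hornerMn hornerC.
  by rewrite subr0 -mulr_natr mulf_neq0 ?expf_neq0.
have : ev S * ev p = (x - cst a) ^+ n.
  rewrite -evM -ES evB evXn evX ev_curve -evB -polyCB [X in X - _]Ef addrK.
  by rewrite polyC_exp evXn evXsubC.
move/(congr1 (ord P)).
rewrite (ordM P (ev_at_neq0 C fac S0) ep0) (affine_ord_unit fac Pac S0).
rewrite add0r ordX ?evXsubC_neq0 // (affine_ord_XsubC fac Pac) (negPf c0) => ->.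
by rewrite natz.
Qed.

Lemma to_jacobian_inf m : to_jacobian inf inf *+ m = 0.
Proof.
apply/jacobian_eq0; exists 1; split; first exact: oner_neq0.
by move=> Q; rewrite Defs.ord1 subrr mul0r.
Qed.

Lemma has_order_affine P m : (1 < m)%N -> point_has_order inf P m ->
  exists a c, c ^+ d = f.[a] /\ is_affine_point P a c.
Proof.
move=> m1 [_ _ min]; have [PE|//] := affine_or_inf P.
by have := min 1%N m1; rewrite PE to_jacobian_inf.
Qed.

Lemma ramified_order P a : (d < n)%N -> f.[a] = 0 -> is_affine_point P a 0 ->
  point_has_order inf P d.
Proof.
move=> dn fa0 Pa; have f0a : 0 ^+ d = f.[a] by rewrite fa0 expr0n gtn_eqF.
split=> //; first exact: ramified_multiple Pa.
move=> k /andP[k0 kd] /(multiple_lt_n f0a Pa) [];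
  first by rewrite k0 (ltn_trans kd).
by move/(dvdn_leq k0); rewrite leqNgt kd.
Qed.

(** [multiple_lt_n] gives d | m and c = 0; then d already kills the class of P, so minimality of m
    gives m = d. *)
Lemma order_lt_n P m : (1 < m < n)%N -> point_has_order inf P m ->
  m = d /\ exists2 a, f.[a] = 0 & is_affine_point P a 0.
Proof.
move=> /andP[m1 mn] Pm; have [a [c [fac Pac]]] := has_order_affine m1 Pm.
have [m0 Pm0 min] := Pm; have m0n : (0 < m < n)%N by rewrite m0.
have [dm c0] := multiple_lt_n fac Pac m0n Pm0.
rewrite c0 in fac Pac; have fa0 : f.[a] = 0 by rewrite -fac expr0n gtn_eqF.
split; last by exists a.
apply/eqP; rewrite eqn_leq (dvdn_leq m0 dm) andbT leqNgt; apply/negP=> lt.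
by apply: (min d); rewrite ?d_gt0 //; apply: ramified_multiple Pac.
Qed.

(** The order is exactly n and not a proper divisor, because a smaller multiple killing the class
    would force c = 0, which separability of f excludes. *)
Lemma order_n_iff P a c : (d < n)%N -> f \is monic ->
  c ^+ d = f.[a] -> is_affine_point P a c ->
  point_has_order inf P n <->
  exists v : {poly K}, (d * (size v).-1 <= n - 1)%N /\ f = ('X - a%:P) ^+ n + v
    ^+ d.
Proof.
move=> dn f_monic fac Pac; have n1 : (1 < n)%N := ltn_trans d_gt1 dn.
split=> [[_ Pn _]|[v [sv Ef]]]; first exact: order_n_power fac Pac f_monic Pn.
have c0 := order_n_point_neq0 fac Ef n1.
split=> //; last by move=> k kn /(multiple_lt_n fac Pac kn)[_ /eqP];
  rewrite (negPf c0).
have va : v.[a] ^+ d = c ^+ d by rewrite fac Ef !hornerE subrr expr0n gtn_eqF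
  ?add0r.
have va0 : v.[a] != 0.
  by apply: contra_neq c0 => va0; move/esym/eqP: va;
    rewrite va0 expr0n gtn_eqF // expf_eq0 d_gt0 => /eqP.
have z0 : c / v.[a] != 0 by rewrite mulf_neq0 ?invr_eq0.
apply: (power_order_n (v := (c / v.[a]) *: v) fac Pac) => //.
- by rewrite size_scale.
- by rewrite exprZn expr_div_n va divff ?expf_neq0 // scale1r.
- by rewrite hornerZ divfK.
Qed.

End Curve.

Theorem theorem1 (K : closedFieldType) (n d : nat)
    (hd : (2 <= d)%N) (hdn : (d < n)%N) (hnd : coprime n d)
    (hchar : forall p : nat, p \in [pchar K] -> ~~ (p %| d)%N)
    (f : {poly K}) (hmonic : f \is monic) (hdeg : size f = n.+1)
    (w : 'I_n -> K) (hw : injective w)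
    (hf : f = \prod_(j < n) ('X - (w j)%:P))
    (C : function_field f d) (inf : point C) (hinf : is_infinity inf) :
  [/\ (forall (P : point C) (m : nat), (1 < m)%N ->
         point_has_order inf P m -> m = d \/ (n <= m)%N),
      (exists P : 'I_n -> point C,
         [/\ injective P,
             forall j : 'I_n, is_affine_point (P j) (w j) 0
           & forall Q : point C,
               point_has_order inf Q d <-> exists j : 'I_n, Q = P j]),
      (forall (a c : K) (P : point C),
         c ^+ d = f.[a] -> is_affine_point P a c ->
         (point_has_order inf P n <->
          exists v : {poly K}, (d * (size v).-1 <= n - 1)%N /\
                               f = ('X - a%:P) ^+ n + v ^+ d))
    & ((exists P : point C, point_has_order inf P n) <->
       exists (a : K) (v : {poly K}),
         (d * (size v).-1 <= n - 1)%N /\ f = ('X - a%:P) ^+ n + v ^+ d)].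
Proof.
have d_gt0 : (0 < d)%N := ltnW hd.
have n_gt1 : (1 < n)%N := ltn_trans hd hdn.
have dK : d%:R != 0 :> K.
  apply/negP=> dK0; have [p pK] := natf0_pchar d_gt0 dK0.
  by move: (hchar p pK); rewrite (dvdn_pcharf pK) dK0.
have f_sep : separable_poly f.
  rewrite hf -(big_map w predT (fun z => 'X - z%:P)) separable_prod_XsubC.
  by rewrite map_inj_uniq // index_enum_uniq.
have fw j : f.[w j] = 0.
  by rewrite hf horner_prod (bigD1 j) //= !hornerE subrr mul0r.
have wP a : f.[a] = 0 -> exists j, a = w j.
  move/eqP; rewrite hf horner_prod => /prodf_eq0[j _].
  by rewrite !hornerE subr_eq0 => /eqP; exists j.
have f0w j : 0 ^+ d = f.[w j] by rewrite fw expr0n gtn_eqF.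
have order_n P a c (fac : c ^+ d = f.[a]) (Pac : is_affine_point P a c) :=
  order_n_iff hd dK f_sep hdeg hnd hinf hdn hmonic fac Pac.
split.
- move=> P m m1 Pm; have [nm|mn] := leqP n m; [by right | left].
  by apply: (proj1 (order_lt_n hd dK f_sep hdeg hnd hinf _ Pm)); rewrite m1.
- have /choice[P PP] j : exists P : point C, is_affine_point P (w j) 0.
    exact: (affine_point_exists C hd dK f_sep (f0w j)).
  exists P; split=> // [i j Eij|Q].
    apply: hw; have Pi := PP i; rewrite Eij in Pi.
    by have [] := affine_point_inj Pi (PP j).
  split=> [Qd|[j ->]]; last exact: (ramified_order hd dK f_sep hdeg hnd hinf
    hdn (fw j) (PP j)).
  have [|_ [a fa0 Qa]] := order_lt_n hd dK f_sep hdeg hnd hinf _ Qd;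
    first by rewrite hd.
  have [j aw] := wP a fa0; exists j; rewrite aw in Qa.
  exact: (affine_point_unique hd dK f_sep (f0w j) (PP j) Qa).
- by move=> a c P fac Pac; exact: (order_n P a c fac Pac).
split=> [[P Pn]|[a [v [sv Ef]]]].
  have [a [c [fac Pac]]] := has_order_affine hd hdeg hnd hinf n_gt1 Pn.
  by exists a; apply/(order_n P a c).
(* The point of order n is (a, v(a)), which lies on the curve because (x - a)^n vanishes at a. *)
have fva : v.[a] ^+ d = f.[a].
  by rewrite [in RHS]Ef !hornerE subrr expr0n gtn_eqF ?add0r // ltnW.
have [P Pa] := affine_point_exists C hd dK f_sep fva.
by exists P; apply/(order_n P a _ fva Pa); exists v.
Qed.
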